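(* Let $1\le p\le q$ be integers and $n=p+q$ (the case $G=Sp(p,q)$). Let $\mu=(a_1,\dots,a_p\mid b_1,\dots,b_q)\in\mathbb{Z}^n$ be $\Delta^+(\mathfrak{k},\mathfrak{t})$-dominant and u-large, and assume that $\mu-\beta$ is also $\Delta^+(\mathfrak{k},\mathfrak{t})$-dominant. Then $$\|\mu\|_{\mathrm{spin}}>\|\mu-\beta\|_{\mathrm{spin}}.$$ Equivalently: along any pencil $\{\mu_0+m\beta\mid m\in\mathbb{Z}_{\ge0}\}$ of $\Delta^+(\mathfrak{k},\mathfrak{t})$-dominant weights, the spin norm strictly increases at each step from $\mu-\beta$ to $\mu$ once $\mu$ is u-large.
   Context: Weights are vectors in $\mathbb{R}^n$ written $(x_1,\dots,x_p\mid y_1,\dots,y_q)$, with the standard inner product $\langle\cdot,\cdot\rangle$ and Euclidean norm $\|\cdot\|$. Put $\rho_c=(p,p-1,\dots,1\mid q,q-1,\dots,1)$ and $\beta=(1,0,\dots,0\mid 1,0,\dots,0)$. A weight is $\Delta^+(\mathfrak{k},\mathfrak{t})$-dominant if $x_1\ge\cdots\ge x_p\ge0$ and $y_1\ge\cdots\ge y_q\ge 0$. For $\nu\in\mathbb{Z}^n$, $\{\nu\}$ denotes the vector obtained by replacing every coordinate by its absolute value and then rearranging the first $p$ coordinates in decreasing order and the last $q$ coordinates in decreasing order; the $\mathfrak{k}$-value is $\|\nu\|_{\mathfrak{k}}:=\|\{\nu\}+\rho_c\|$. Let $\Omega_{p,q}$ be the set of $(x_1,\dots,x_p\mid y_1,\dots,y_q)\in\mathbb{Z}^n$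 with $q\ge x_1\ge\cdots\ge x_p\ge0$ and $y_j=\#\{i\mid q-x_i\ge j\}$ for $1\le j\le q$ (these are exactly the vectors $\rho_n^{(\ell)}=w\rho-\rho_c$, $\rho=(n,n-1,\dots,1)$, as $w$ runs over the Weyl group elements making $\Delta^+(\mathfrak{k},\mathfrak{t})\cup w\Delta^+(\mathfrak{p},\mathfrak{t})$ a positive system). The spin norm of a $\Delta^+(\mathfrak{k},\mathfrak{t})$-dominant $\nu\in\mathbb{Z}^n$ is $\|\nu\|_{\mathrm{spin}}:=\min_{\tau\in\Omega_{p,q}}\|\nu-\tau\|_{\mathfrak{k}}$. A dominant integral weight $\mu=(a_1,\dots,a_p\mid b_1,\dots,b_q)$ is called u-large (i.e. not in the unitarily small convex hull of Salamanca-Riba–Vogan) if there exist $0\le f\le p$ and $0\le g\le q$ with $\sum_{i=1}^f a_i+\sum_{j=1}^g b_j>2pq-2(p-f)(q-g)$; otherwise it is u-small. *)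

(* Defs.v *)
From mathcomp Require Import all_boot all_order all_algebra.
Set Implicit Arguments. Unset Strict Implicit. Unset Printing Implicit Defensive.
Import Order.TTheory GRing.Theory Num.Theory.
Local Open Scope ring_scope.

(* A weight (x_1..x_p | y_1..y_q) in Z^n, n = p+q, is a pair of integer row
   vectors x : 'rV[int]_p, y : 'rV[int]_q; coordinate x_{i+1} is x 0 i. *)

Definition dom_block (m : nat) (x : 'rV[int]_m) : Prop :=
  (forall i j : 'I_m, (i <= j)%N -> x 0 j <= x 0 i) /\ (forall i : 'I_m, 0 <= x 0 i).

Definition kdominant (p q : nat) (x : 'rV[int]_p) (y : 'rV[int]_q) : Prop :=
  dom_block x /\ dom_block y.

Definition beta_block (m : nat) : 'rV[int]_m := \row_(i < m) ((i == 0 :> nat) : int).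

(* For one block s, {s} = absolute values sorted decreasingly; the squared
   norm of {s} + (m, m-1, ..., 1) with m = size s. *)
Definition kpart_sq (s : seq int) : int :=
  let t := sort (fun a b : int => b <= a) [seq `|a| | a <- s] in
  \sum_(i < size t) (t`_i + (size t - i)%:Z) ^+ 2.

Definition row_seq (m : nat) (x : 'rV[int]_m) : seq int := [seq x 0 i | i <- enum 'I_m].

(* ||nu||_k = || {nu} + rho_c || *)
Definition knorm (R : rcfType) (p q : nat) (x : 'rV[int]_p) (y : 'rV[int]_q) : R :=
  Num.sqrt ((kpart_sq (row_seq x) + kpart_sq (row_seq y))%:~R).

(* Omega_{p,q}: parametrised by d : 'I_p -> {0..q}, non-increasing; the
   element is (d_1..d_p | y) with y_j = #{i | q - d_i >= j}. *)
Definition omega_ok (p q : nat) (d : {ffun 'I_p -> 'I_q.+1}) : bool :=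
  [forall i : 'I_p, forall j : 'I_p, (i <= j)%N ==> (d j <= d i)%N].

Definition omega_x (p q : nat) (d : {ffun 'I_p -> 'I_q.+1}) : 'rV[int]_p :=
  \row_(i < p) ((d i : nat) : int).

Definition omega_y (p q : nat) (d : {ffun 'I_p -> 'I_q.+1}) : 'rV[int]_q :=
  \row_(j < q) (#|[set i : 'I_p | (j.+1 <= q - d i)%N]| : int).

Definition omega0 (p q : nat) : {ffun 'I_p -> 'I_q.+1} := [ffun => ord0].

Definition spin_norm (R : rcfType) (p q : nat) (x : 'rV[int]_p) (y : 'rV[int]_q) : R :=
  \big[Num.min/knorm R (x - omega_x (omega0 p q)) (y - omega_y (omega0 p q))]_(d | omega_ok d)
     knorm R (x - omega_x d) (y - omega_y d).

Definition u_large (p q : nat) (a : 'rV[int]_p) (b : 'rV[int]_q) : Prop :=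
  exists (f : 'I_p.+1) (g : 'I_q.+1),
    (\sum_(i < p | (i < f)%N) a 0 i) + (\sum_(j < q | (j < g)%N) b 0 j)
      > 2%:Z * (p * q)%:Z - 2%:Z * ((p - f)%:Z * (q - g)%:Z).

(* Main.v *)
(** If t is the decreasing rearrangement of nonnegative u_1, ..., u_m, then
    2 sum_i t_i (m - i + 1) = sum_i u_i + sum_(i,j) max(u_i, u_j), so the squared
    k-norm is, up to a constant, a symmetric form in |nu| that is monotone and
    does not increase when two entries are moved towards each other.

    Let tau = (x | y) be optimal for mu.  If a_1 > x_1 and b_1 > y_1, the same tau
    is strictly better for mu - beta.  Otherwise, since mu is u-large, exactly one
    of these fails; say b_1 <= y_1 = k, and then a_1 > q.  Let i be the first row
    with x_i < q and j the last column with y_j = k, a removable corner.  If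
    a_i > x_i, moving the corner (x_i + 1, y_j - 1) increases no entry of |nu| in
    the first block and decreases its first entry, while the second block undergoes
    a transfer of one unit from entry j to the smaller entry 1 (or, if j = 1, no
    change).  If a_i <= x_i, u-largeness forces a_1 > 2q; then a_1 - x_1
    strictly dominates the first block, and with tau unchanged the gain there
    outweighs the loss at b_1. *)

Require Import Defs.
From mathcomp Require Import all_boot all_order all_algebra.
From mathcomp Require Import zify ring.
Import Order.TTheory GRing.Theory Num.Theory.
Local Open Scope ring_scope.

(** * The symmetric form behind the squared k-norm *)

Definition maxform {I : finType} (P : pred I) (u : I -> int) : int :=
  \sum_(i | P i) (u i ^+ 2 + u i) + \sum_(i | P i) \sum_(j | P j) Num.max (u i) (u j).

Lemma maxformD1 {I : finType} (P : pred I) (u : I -> int) (a : I) : P a ->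
  maxform P u = u a ^+ 2 + u a *+ 2
    + (\sum_(j | P j && (j != a)) Num.max (u a) (u j)) *+ 2
    + maxform [pred i | P i && (i != a)] u.
Proof.
move=> Pa; rewrite /maxform (bigD1 a) //= [X in _ + X = _](bigD1 a) //=.
rewrite [X in _ + (X + _) = _](bigD1 a) //= maxxx.
under [X in _ + (_ + X) = _]eq_bigr => i _ do rewrite (bigD1 a) //= maxC.
rewrite !big_split /=; ring.
Qed.

Lemma eq_maxform {I : finType} (P : pred I) (u v : I -> int) :
  (forall i, P i -> u i = v i) -> maxform P u = maxform P v.
Proof.
move=> uv; rewrite /maxform; congr (_ + _); apply: eq_bigr => i Pi; rewrite uv //.
by apply: eq_bigr => j Pj; rewrite uv.
Qed.

Lemma le_maxform {I : finType} (P : pred I) (u v : I -> int) :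
  (forall i, P i -> 0 <= u i <= v i) -> maxform P u <= maxform P v.
Proof.
move=> uv; apply: lerD; apply: ler_sum => i Pi; have := uv i Pi; first nia.
by move=> ui; apply: ler_sum => j Pj; have := uv j Pj; lia.
Qed.

Lemma lt_maxform {I : finType} (P : pred I) (u v : I -> int) (a : I) :
  P a -> (forall i, P i -> 0 <= u i <= v i) -> u a < v a ->
  maxform P u < maxform P v.
Proof.
move=> Pa uv uva; rewrite !(maxformD1 _ _ _ Pa).
have := uv a Pa => uva'.
have : maxform [pred i | P i && (i != a)] u <= maxform [pred i | P i && (i != a)] v.
  by apply: le_maxform => i /andP[Pi _]; apply: uv.
have : \sum_(j | P j && (j != a)) Num.max (u a) (u j) <=
       \sum_(j | P j && (j != a)) Num.max (v a) (v j).
  by apply: ler_sum => j /andP[Pj _]; have := uv j Pj; lia.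
nia.
Qed.

(** The sum is unchanged, the sum of squares does not grow, and for each third entry [c] the map
    [t -> max t c] is convex, so its values at the two moved entries do not grow in total. *)
Lemma maxform_transfer {I : finType} (u v : I -> int) (a b : I) :
  a != b -> u a < u b -> v a = u a + 1 -> v b = u b - 1 ->
  (forall i, i != a -> i != b -> v i = u i) ->
  maxform xpredT v <= maxform xpredT u.
Proof.
move=> ab uab va vb vi.
have ba : [pred i | xpredT i && (i != a)] b by rewrite /= eq_sym.
rewrite !(maxformD1 xpredT _ a) // !(maxformD1 _ _ b ba) /=.
rewrite !(bigD1 (P := fun j => j != a) b) 1?eq_sym //=.
rewrite (eq_maxform _ v u); last by move=> i /andP[ia ib]; apply: vi.
have : \sum_(i | (i != a) && (i != b)) (Num.max (v a) (v i) + Num.max (v b) (v i)) <=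
       \sum_(i | (i != a) && (i != b)) (Num.max (u a) (u i) + Num.max (u b) (u i)).
  by apply: ler_sum => i /andP[ia ib]; rewrite (vi i) //; lia.
rewrite !big_split /= va vb.
have -> : (u a + 1) ^+ 2 = u a ^+ 2 + u a *+ 2 + 1 by ring.
have -> : (u b - 1) ^+ 2 = u b ^+ 2 - u b *+ 2 + 1 by ring.
do 4![move: (\sum_(_ | _) _) => ?].
by move: (u a ^+ 2) (u b ^+ 2) => ? ?; lia.
Qed.

(** Strict dominance keeps entry [ord0] maximal after the decrease, so each of its cross terms
    equals the entry itself and drops by exactly 1. *)
Lemma maxform_decr {p : nat} (u v : 'I_p.+1 -> int) :
  (forall i, i != ord0 -> u i < u ord0) -> v ord0 = u ord0 - 1 ->
  (forall i, i != ord0 -> v i = u i) ->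
  maxform xpredT u = maxform xpredT v + 2 * (u ord0 + p%:Z) + 1.
Proof.
move=> u0 v0 vi; rewrite !(maxformD1 xpredT _ ord0) //=.
rewrite (eq_maxform _ v u) //.
have E (c : int) (w : _ -> int) : (forall i : 'I_p.+1, i != ord0 -> w i <= c) ->
    \sum_(i < p.+1 | i != ord0) Num.max c (w i) = c * p%:Z.
  move=> H; rewrite (eq_bigr (fun=> c)); last by move=> i /H; lia.
  by rewrite sumr_const cardC1 card_ord -mulr_natr natz.
rewrite (E _ u); last by move=> i i0; have := u0 _ i0; lia.
rewrite (E _ v); last by move=> i i0; have := u0 _ i0; rewrite (vi i) //; lia.
by rewrite v0; ring.
Qed.

Lemma maxform_incr {q : nat} (u v : 'I_q.+1 -> int) :
  v ord0 = u ord0 + 1 -> (forall i, i != ord0 -> v i = u i) ->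
  maxform xpredT v <= maxform xpredT u + 2 * (u ord0 + q%:Z) + 3.
Proof.
move=> v0 vi; rewrite !(maxformD1 xpredT _ ord0) //=.
rewrite (eq_maxform _ v u) //.
have : \sum_(i < q.+1 | i != ord0) Num.max (v ord0) (v i) <=
       \sum_(i < q.+1 | i != ord0) (Num.max (u ord0) (u i) + 1).
  by apply: ler_sum => i i0; rewrite (vi i) //; lia.
rewrite big_split /= sumr_const cardC1 card_ord natz v0.
do 2![move: (\sum_(_ | _) _) => ?]; nia.
Qed.

(** * The squared k-norm of a block as [maxform] plus a constant *)

(** Induction on [t]: the head dominates the tail, so its maxima with the tail add up to the cross
    term of its square, while the tail keeps its own part of [rho_c]. *)
Lemma kpart_sorted (t : seq int) : sorted (fun a b : int => b <= a) t ->
  \sum_(i < size t) (t`_i + (size t - i)%:Z) ^+ 2 =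
  \sum_(x <- t) (x ^+ 2 + x) + \sum_(x <- t) \sum_(y <- t) Num.max x y
  + \sum_(i < size t) (i.+1%:Z) ^+ 2.
Proof.
elim: t => [|x t IH] /=; first by rewrite !big_ord0 !big_nil.
rewrite path_sortedE; last by move=> a b c; lia.
case/andP=> /allP xt /IH {}IH.
rewrite big_ord_recl big_ord_recr /= subn0.
under eq_bigr => i _ do rewrite subSS.
rewrite IH !big_cons maxxx.
under [X in _ = _ + (_ + X) + _]eq_bigr => y _ do rewrite big_cons maxC.
have E : \sum_(y <- t) Num.max x y = x * (size t)%:Z.
  rewrite big_seq (eq_bigr (fun=> x)) -?big_seq.
    by rewrite big_const_seq count_predT iter_addr_0 -mulr_natr natz.
  by move=> y /xt; lia.
by rewrite !big_split /= !E intS; ring.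
Qed.

Lemma kpart_sqE (m : nat) (x : 'rV[int]_m) :
  kpart_sq (row_seq x) =
    maxform xpredT (fun i => `|x 0 i|) + \sum_(i < m) (i.+1%:Z) ^+ 2.
Proof.
rewrite /kpart_sq kpart_sorted; last by apply: sort_sorted => a b; lia.
set t := sort _ _.
have pt : perm_eq t [seq `|a| | a <- row_seq x] by rewrite perm_sort.
have st : size t = m by rewrite (perm_size pt) /row_seq 2!size_map size_enum_ord.
have bigE (F : int -> int) : \sum_(y <- t) F y = \sum_(i < m) F `|x 0 i|.
  by rewrite (perm_big _ pt) /= 2!big_map big_enum.
rewrite st /maxform !bigE; congr (_ + _ + _).
by apply: eq_bigr => i _; rewrite bigE.
Qed.

(** * Omega as a relation symmetric in the two blocks *)

(* With 0-based indices, y_j = #{i | x_i + j < q} consists of the last y_j rows;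
   this form of membership in Omega is symmetric in the two blocks. *)
Definition omega_rel (p q : nat) (x : 'I_p -> nat) (y : 'I_q -> nat) : Prop :=
  [/\ forall i : 'I_p, (x i <= q)%N, forall j : 'I_q, (y j <= p)%N
    & forall (i : 'I_p) (j : 'I_q), (x i + j < q)%N = (p <= i + y j)%N].

Lemma omega_rel_sym (p q : nat) (x : 'I_p -> nat) (y : 'I_q -> nat) :
  omega_rel p q x y -> omega_rel q p y x.
Proof. by case=> xq yp xy; split=> // j i; have := xy i j; lia. Qed.

Lemma card_ord_geq (p n : nat) : #|[set i : 'I_p | (n <= i)%N]| = (p - n)%N.
Proof.
rewrite cardsE -sum1_card big_mkcond /=.
elim: p => [|p IH]; first by rewrite big_ord0.
by rewrite big_ord_recr /= IH unfold_in /=; case: eqnP; lia.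
Qed.

(** As [d] is non-increasing, the rows counted in column [j] form a final segment, so membership of
    a row can be read off from the cardinality. *)
Lemma omega_rel_ok (p q : nat) (d : {ffun 'I_p -> 'I_q.+1}) : omega_ok d ->
  omega_rel p q (fun i => d i)
    (fun j => #|[set i : 'I_p | (j.+1 <= q - d i)%N]|).
Proof.
move=> /forallP dP.
have {}dP (i i' : 'I_p) : (i <= i')%N -> (d i' <= d i)%N.
  by have /forallP /(_ i') /implyP := dP i.
split=> [i|j|i j]; first by rewrite -ltnS.
  by rewrite -[X in (_ <= X)%N]card_ord max_card.
set S := [set i | _].
case: ltnP => h; symmetry.
  suff : (p - i <= #|S|)%N by lia.
  rewrite -card_ord_geq; apply: subset_leq_card; apply/subsetP => i'.
  by rewrite !inE => /dP; lia.
have := ltn_ord i; suff : (#|S| <= p - i.+1)%N by lia.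
rewrite -card_ord_geq; apply: subset_leq_card; apply/subsetP => i'.
rewrite !inE => h'; rewrite ltnNge; apply/negP => /dP; lia.
Qed.

Lemma omega_ok_rel (p q : nat) (x : 'I_p -> nat) (y : 'I_q -> nat) :
  omega_rel p q x y ->
  exists d : {ffun 'I_p -> 'I_q.+1}, [/\ omega_ok d,
    forall i, omega_x d 0 i = x i & forall j, omega_y d 0 j = y j].
Proof.
move=> [xq yp xy]; exists [ffun i => inord (x i)].
have dE i : ([ffun i => inord (x i)] : {ffun 'I_p -> 'I_q.+1}) i = x i :> nat.
  by rewrite ffunE inordK // ltnS.
split=> [|i|j].
- apply/forallP => i; apply/forallP => i'; apply/implyP => ii'.
  rewrite !dE leqNgt; apply/negP => lt_x.
  (* Column [q - x i'] contains row [i] but not the later row [i'], contradicting that columns are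
     final segments. *)
  have lt_q : (q - x i' < q)%N by have := xq i'; lia.
  have := xy i (Ordinal lt_q); have := xy i' (Ordinal lt_q) => /=.
  by have := xq i'; lia.
- by rewrite mxE dE.
- rewrite mxE; congr Posz; have := card_ord_geq p (p - y j).
  rewrite (_ : (p - (p - y j))%N = y j); last by have := yp j; lia.
  move=> <-; apply: eq_card => i; rewrite !inE dE.
  by have := xy i j; lia.
Qed.

(** * A criterion against u-largeness *)

(* Rows i < e get their full quota 2q; the rest is bounded by (q, ..., q | k, ..., k)
   with k = p - e, which is u-small for Sp(k, q) because 2fg <= fq + gk. *)
Lemma not_u_large (p q : nat) (a : 'rV[int]_p) (b : 'rV[int]_q) (e : nat) :
  (e <= p)%N ->
  (forall i, a 0 i <= (q + (i < e) * q)%N%:Z) ->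
  (forall j, b 0 j <= (p - e)%N%:Z) -> ~ u_large a b.
Proof.
move=> ep ha hb [f [g]]; rewrite ltNge => /negP; apply.
have fp : (f <= p)%N by rewrite -ltnS.
have gq : (g <= q)%N by rewrite -ltnS.
have A : \sum_(i < p | (i < f)%N) a 0 i <= (f * q + minn f e * q)%N%:Z.
  apply: le_trans (ler_sum _ (fun i _ => ha i)) _.
  rewrite -(big_ord_widen _ (fun i => (q + (i < e) * q)%N%:Z) fp).
  elim: (f : nat) => [|n IH]; first by rewrite big_ord0.
  by rewrite big_ord_recr /=; apply: le_trans (lerD IH (lexx _)) _; nia.
have B : \sum_(j < q | (j < g)%N) b 0 j <= (g * (p - e))%N%:Z.
  apply: le_trans (ler_sum _ (fun i _ => hb i)) _.
  rewrite -(big_ord_widen _ (fun i => (p - e)%N%:Z) gq).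
  by rewrite sumr_const card_ord; lia.
apply: le_trans (lerD A B) _.
case: (leqP f e) => fe; nia.
Qed.

Lemma u_large_sym (p q : nat) (a : 'rV[int]_p) (b : 'rV[int]_q) :
  u_large a b -> u_large b a.
Proof. by case=> f [g h]; exists g, f; rewrite addrC; lia. Qed.

(** * Improving an element of Omega on passing to mu - beta *)

Definition shifted_form {m : nat} (a : 'rV[int]_m) (x : 'I_m -> nat) : int :=
  maxform xpredT (fun i => `|a 0 i - (x i)%:Z|).

Lemma shifted_form_ge0 {m : nat} (a : 'rV[int]_m) (x : 'I_m -> nat) :
  0 <= shifted_form a x.
Proof.
apply: addr_ge0; apply: sumr_ge0 => i _; first by rewrite addr_ge0 ?sqr_ge0.
by apply: sumr_ge0 => j _; rewrite le_max normr_ge0.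
Qed.

Definition improvable {p q : nat} (a : 'rV[int]_p) (b : 'rV[int]_q)
    (x : 'I_p -> nat) (y : 'I_q -> nat) : Prop :=
  exists x' y', omega_rel p q x' y' /\
    shifted_form (a - beta_block p) x' + shifted_form (b - beta_block q) y' <
    shifted_form a x + shifted_form b y.

Lemma improvable_sym {p q : nat} (a : 'rV[int]_p) (b : 'rV[int]_q)
    (x : 'I_p -> nat) (y : 'I_q -> nat) :
  improvable b a y x -> improvable a b x y.
Proof.
case=> y' [x' [xy' lt]]; exists x', y'; split; first exact: omega_rel_sym.
by rewrite addrC [X in _ < X]addrC.
Qed.

Lemma sub_beta0 (m : nat) (a : 'rV[int]_m.+1) :
  (a - beta_block m.+1) 0 ord0 = a 0 ord0 - 1.
Proof. by rewrite !mxE. Qed.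

Lemma sub_beta_neq0 (m : nat) (a : 'rV[int]_m.+1) (i : 'I_m.+1) : i != ord0 ->
  (a - beta_block m.+1) 0 i = a 0 i.
Proof. by rewrite !mxE -val_eqE /= => /negPf ->; rewrite subr0. Qed.

Lemma dom_block_lt (m : nat) (a : 'rV[int]_m.+1) :
  dom_block (a - beta_block m.+1) ->
  1 <= a 0 ord0 /\ forall i, i != ord0 -> a 0 i < a 0 ord0.
Proof.
case=> mono pos; split; first by have := pos ord0; rewrite sub_beta0; lia.
move=> i i0; have := mono ord0 i (leq0n _).
by rewrite sub_beta0 sub_beta_neq0 //; lia.
Qed.

Lemma dom_block_le0 (m : nat) (a : 'rV[int]_m.+1) (i : 'I_m.+1) :
  dom_block a -> a 0 i <= a 0 ord0.
Proof. by case=> mono _; apply: mono. Qed.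

Lemma shifted_form_lt (m : nat) (a : 'rV[int]_m.+1) (x : 'I_m.+1 -> nat) :
  (x ord0)%:Z < a 0 ord0 ->
  shifted_form (a - beta_block m.+1) x < shifted_form a x.
Proof.
move=> lt0; apply: (lt_maxform _ _ _ ord0) => // [i _|].
  have [->|i0] := eqVneq i ord0; first by rewrite sub_beta0; lia.
  by rewrite sub_beta_neq0 //; lia.
by rewrite sub_beta0; lia.
Qed.

(** Cell [(i0, j0)] is a corner of the region [x i + j < q], and both sides of the equivalence
    change at this cell only. Since [i0 < p], [y j0] is positive and the subtraction is not
    truncated. *)
Lemma omega_rel_move (p q : nat) (x : 'I_p -> nat) (y : 'I_q -> nat)
    (i0 : 'I_p) (j0 : 'I_q) :
  omega_rel p q x y -> (x i0 + j0).+1 = q -> (i0 + y j0)%N = p ->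
  omega_rel p q (fun i => x i + (i == i0))%N (fun j => y j - (j == j0))%N.
Proof.
case=> xq yp xy qE pE; split=> [i|j|i j].
- have := xq i; have := ltn_ord j0.
  by have [->|_] := eqVneq i i0; lia.
- by have := yp j; lia.
- have := xy i j; have := ltn_ord i0; have := ltn_ord i.
  have [->|ne] := eqVneq i i0; have [->|ne'] := eqVneq j j0; try lia.
    by rewrite -val_eqE /= in ne'; lia.
  by rewrite -val_eqE /= in ne; lia.
Qed.

Lemma improvable_left (p q : nat) (a : 'rV[int]_p.+1) (b : 'rV[int]_q.+1)
    (x : 'I_p.+1 -> nat) (y : 'I_q.+1 -> nat) :
  omega_rel p.+1 q.+1 x y -> kdominant a b ->
  kdominant (a - beta_block p.+1) (b - beta_block q.+1) -> u_large a b ->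
  q.+1%:Z < a 0 ord0 -> b 0 ord0 <= (y ord0)%:Z -> improvable a b x y.
Proof.
move=> om [da db] [/dom_block_lt [a0 lta] /dom_block_lt [b0 ltb]] large lt_qa le_by.
have [xq yp xy] := om.
(* The rows with [x i < q.+1] are the last [y ord0] ones, and [y ord0] is positive because
   [1 <= b 0 ord0]; so [i0] is the first of them. *)
have [i0 i0E] : exists i0 : 'I_p.+1, (i0 + y ord0)%N = p.+1.
  have lt_i0 : (p.+1 - y ord0 < p.+1)%N by lia.
  by exists (Ordinal lt_i0); have := yp ord0 => /=; lia.
have x_lt (i : 'I_p.+1) : (i < i0)%N -> x i = q.+1.
  by move=> lt; have := xy i ord0; have := xq i; rewrite addn0; lia.
have xi0 : (x i0 < q.+1)%N by have := xy i0 ord0; rewrite addn0; lia.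
case: (ltP (x i0)%:Z (a 0 i0)) => [lt_xa|le_ax].
  have [j0 j0E] : exists j0 : 'I_q.+1, (x i0 + j0).+1 = q.+1.
    have lt_j0 : (q - x i0 < q.+1)%N by lia.
    by exists (Ordinal lt_j0) => /=; lia.
  (* Row [i0] lies in column [j0], while the row before it, if any, lies in no column. *)
  have yj0 : y j0 = y ord0.
    have := xy i0 j0; have := yp j0.
    have lt_p : (i0.-1 < p.+1)%N by have := ltn_ord i0; lia.
    have := xy (Ordinal lt_p) j0; have := xy (Ordinal lt_p) ord0.
    by move=> /=; lia.
  have om' : omega_rel p.+1 q.+1 (fun i => x i + (i == i0))%N
                                 (fun j => y j - (j == j0))%N.
    by apply: omega_rel_move; rewrite ?yj0.
  exists (fun i => x i + (i == i0))%N, (fun j => y j - (j == j0))%N.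
  split=> //; apply: ltr_leD.
    apply: (lt_maxform _ _ _ ord0) => // [i _|].
      have [->|ne0] := eqVneq i ord0.
        rewrite sub_beta0; have := xq ord0; case: eqP => [e|_]; last by lia.
        by have := xi0; rewrite -e; lia.
      rewrite sub_beta_neq0 //; have [e|_] := eqVneq i i0; last by lia.
      by rewrite e; lia.
    rewrite sub_beta0; have := xq ord0; case: eqP => [e|_]; last by lia.
    by have := xi0; rewrite -e; lia.
  have [e|ne] := eqVneq j0 ord0.
    rewrite /shifted_form le_eqVlt; apply/orP; left; apply/eqP.
    apply: eq_maxform => j _; rewrite e.
    have [->|ne] := eqVneq j ord0; first by rewrite sub_beta0; lia.
    by rewrite sub_beta_neq0 // subn0.
  (* Both columns have the same [y], and [b 0 j0 < b 0 ord0 <= y ord0], so entry [j0] has the larger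
     absolute value. *)
  apply: (maxform_transfer _ _ ord0 j0); first by rewrite eq_sym.
  - by have := ltb _ ne; rewrite yj0; lia.
  - by rewrite sub_beta0 eq_sym (negPf ne); lia.
  - by have := ltb _ ne; rewrite sub_beta_neq0 // eqxx yj0; lia.
  - by move=> j j_0 jj0; rewrite sub_beta_neq0 // (negPf jj0) subn0.
exists x, y; split=> //.
have a_ge (i : 'I_p.+1) : (i0 <= i)%N -> a 0 i < q.+1%:Z.
  by case: da => mono _ /mono; lia.
(* Otherwise [not_u_large] applies with [e = i0]: rows from [i0] on are below [q.+1], and [b] is at
   most [y ord0 = p.+1 - i0]. *)
have lt_2q : (q.+1 + q.+1)%N%:Z < a 0 ord0.
  rewrite ltNge; apply/negP => le_2q.
  apply: (not_u_large _ _ _ _ i0 _ _ _ large); first exact: ltnW.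
    move=> i; case: (ltnP i i0) => [_|/a_ge]; last by lia.
    by apply: le_trans (dom_block_le0 _ _ i da) _; lia.
  by move=> j; apply: le_trans (dom_block_le0 _ _ j db) _; lia.
have x0 : x ord0 = q.+1.
  apply: x_lt; case: (posnP i0) => // e.
  by have := a_ge ord0; rewrite e; lia.
have decr : shifted_form a x = shifted_form (a - beta_block p.+1) x
    + 2 * (`|a 0 ord0 - (x ord0)%:Z| + p%:Z) + 1.
  (* Rows before [i0] have the same shift [q.+1] and smaller [a]; from [i0] on, entries are at most
     [q.+1] in absolute value. Both stay below [a 0 ord0 - q.+1] by [lt_2q]. *)
  apply: maxform_decr => [i ne||i ne]; last by rewrite sub_beta_neq0.
    have := xq i; rewrite x0; case: (ltnP i i0) => [/x_lt ->|ge].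
      by have := lta _ ne; case: da => _ /(_ i); lia.
    by have := a_ge _ ge; case: da => _ /(_ i); lia.
  by rewrite sub_beta0 x0; lia.
have : shifted_form (b - beta_block q.+1) y <= shifted_form b y
    + 2 * (`|b 0 ord0 - (y ord0)%:Z| + q%:Z) + 3.
  apply: maxform_incr => [|i ne]; last by rewrite sub_beta_neq0.
  by rewrite sub_beta0; lia.
(* The gain is at least [2 * (q + 2 + p) + 1]; the loss is at most [2 * (p + q) + 3], as
   [y ord0 <= p.+1] and [1 <= b 0 ord0]. *)
have := yp ord0; rewrite decr x0; lia.
Qed.

Lemma improvableP (p q : nat) (a : 'rV[int]_p.+1) (b : 'rV[int]_q.+1)
    (x : 'I_p.+1 -> nat) (y : 'I_q.+1 -> nat) :
  omega_rel p.+1 q.+1 x y -> kdominant a b ->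
  kdominant (a - beta_block p.+1) (b - beta_block q.+1) -> u_large a b ->
  improvable a b x y.
Proof.
move=> om dom domB large; have [xq yp _] := om.
case: (ltP (x ord0)%:Z (a 0 ord0)) => [lt_xa|le_ax].
  case: (ltP (y ord0)%:Z (b 0 ord0)) => [lt_yb|le_by].
    by exists x, y; split=> //; apply: ltrD; apply: shifted_form_lt.
  apply: improvable_left => //; rewrite ltNge; apply/negP => le_aq.
  have [da db] := dom; apply: (not_u_large _ _ _ _ 0 _ _ _ large) => //.
    by move=> i; apply: le_trans (dom_block_le0 _ _ i da) _; lia.
  move=> j; apply: le_trans (dom_block_le0 _ _ j db) _.
  by have := yp ord0; lia.
(* Here [a 0 ord0 <= x ord0 <= q.+1], so u-largeness forces [p.+1 < b 0 ord0]: the previous case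
   with the blocks exchanged. *)
apply: improvable_sym; have [[da db] [daB dbB]] := (dom, domB).
apply: improvable_left => //; [exact: omega_rel_sym|exact: u_large_sym|].
rewrite ltNge; apply/negP => le_bp.
apply: (not_u_large _ _ _ _ 0 _ _ _ large) => //.
  move=> i; apply: le_trans (dom_block_le0 _ _ i da) _.
  by have := xq ord0; lia.
by move=> j; apply: le_trans (dom_block_le0 _ _ j db) _; lia.
Qed.

(** * Passage to the spin norm *)

Lemma knormE (R : rcfType) (p q : nat) (a : 'rV[int]_p) (b : 'rV[int]_q)
    (d : {ffun 'I_p -> 'I_q.+1}) (x : 'I_p -> nat) (y : 'I_q -> nat) :
  (forall i, omega_x d 0 i = x i) -> (forall j, omega_y d 0 j = y j) ->
  knorm R (a - omega_x d) (b - omega_y d) =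
  Num.sqrt ((shifted_form a x + shifted_form b y
    + (\sum_(i < p) (i.+1%:Z) ^+ 2 + \sum_(i < q) (i.+1%:Z) ^+ 2))%:~R).
Proof.
move=> dx dy; rewrite /knorm !kpart_sqE addrACA /shifted_form.
congr (Num.sqrt (_ + _ + _)%:~R); apply: eq_maxform => i _.
  by rewrite mxE [X in _ + X]mxE dx.
by rewrite mxE [X in _ + X]mxE dy.
Qed.

(** The default value of the iterated minimum is the value at [omega0], itself a member of Omega. *)
Lemma spin_norm_attained (R : rcfType) (p q : nat) (a : 'rV[int]_p) (b : 'rV[int]_q) :
  exists2 d : {ffun 'I_p -> 'I_q.+1}, omega_ok d &
    spin_norm R a b = knorm R (a - omega_x d) (b - omega_y d).
Proof.
rewrite /spin_norm; apply: (big_ind (fun z => exists2 d, omega_ok d &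
  z = knorm R (a - omega_x d) (b - omega_y d))).
- exists (omega0 p q) => //; apply/forallP => i; apply/forallP => j.
  by rewrite !ffunE leqnn implybT.
- by move=> x y [d dP ->] [e eP ->]; rewrite /Num.min; case: ifP => _;
    [exists d|exists e].
- by move=> d dP; exists d.
Qed.

Theorem theorem1p1 (R : rcfType) (p q : nat) (hp : (1 <= p)%N) (hpq : (p <= q)%N)
    (a : 'rV[int]_p) (b : 'rV[int]_q) :
  kdominant a b -> u_large a b ->
  kdominant (a - beta_block p) (b - beta_block q) ->
  spin_norm R (a - beta_block p) (b - beta_block q) < spin_norm R a b.
Proof.
case: p q hp hpq a b => [|p] [|q] // _ _ a b dom large domB.
have [d dP ->] := spin_norm_attained R _ _ a b.
have om := omega_rel_ok _ _ d dP.
have [x' [y' [om' lt]]] := improvableP _ _ _ _ _ _ om dom domB large.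
have [d' [d'P dx dy]] := omega_ok_rel _ _ _ _ om'.
apply: le_lt_trans (bigmin_le_cond _ _ d'P) _.
rewrite (knormE _ _ _ _ _ d' _ _ dx dy).
rewrite (knormE _ _ _ _ _ d (fun i => d i : nat)
  (fun j => #|[set i : 'I_p.+1 | (j.+1 <= q.+1 - d i)%N]|)).
- have C_ge0 m : 0 <= \sum_(i < m) (i.+1%:Z) ^+ 2.
    by apply: sumr_ge0 => i _; apply: sqr_ge0.
  rewrite ltr_sqrt ?ltr_int ?ltr0z ?ltrD2r //.
  (* Strictness of [Num.sqrt] requires a positive larger argument; the form for mu exceeds a
     nonnegative one. *)
  apply: ltr_wpDr; first by rewrite addr_ge0 ?C_ge0.
  by apply: le_lt_trans lt; rewrite addr_ge0 ?shifted_form_ge0.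
- by move=> i; rewrite mxE.
- by move=> j; rewrite mxE.
Qed.
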